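(* Let $g:\mathbb{R}^{d_x}\times\mathbb{R}^{d_y}\to\mathbb{R}$ and let $Y^*(x)=\arg\min_{y\in\mathbb{R}^{d_y}}g(x,y)$. Suppose that for every $x\in\mathbb{R}^{d_x}$ the set $Y^*(x)$ is non-empty and compact. For a function $f:\mathbb{R}^{d_x}\times\mathbb{R}^{d_y}\to\mathbb{R}$ let $\varphi(x)=\min_{y\in Y^*(x)}f(x,y)$. Then: (a) If $f$ and $Y^*$ are continuous, then $\varphi$ is continuous. (b) Conversely, if $\varphi$ is continuous for every continuous $f$, then $Y^*$ is continuous. (c) If $f$ and $Y^*$ are locally Lipschitz, then $\varphi$ is locally Lipschitz. (d) Conversely, if $\varphi$ is locally Lipschitz for every locally Lipschitz function $f$, then $Y^*$ is locally Lipschitz. (e) If $f$ is $C_f$-Lipschitz and $Y^*$ is $\kappa$-Lipschitz, then $\varphi$ is $C_\varphi$-Lipschitz with $C_\varphi=(\kappa+1)C_f$. (f) Conversely, if $\varphi$ is $C_\varphi$-Lipschitz for every $C_f$-Lipschitz $f$, then $Y^*$ is $\kappa$-Lipschitz with $\kappa=C_\varphi/C_f$.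
   Context: $\|\cdot\|$ is the Euclidean norm and $\mathbb{B}_\delta(x)=\{x':\|x'-x\|\le\delta\}$. The Hausdorff distance between $S_1,S_2\subseteq\mathbb{R}^d$ is $$\mathrm{dist}(S_1,S_2)=\max\Big\{\sup_{x_1\in S_1}\inf_{x_2\in S_2}\|x_1-x_2\|,\ \sup_{x_2\in S_2}\inf_{x_1\in S_1}\|x_1-x_2\|\Big\}.$$ A set-valued mapping $S:\mathbb{R}^n\rightrightarrows\mathbb{R}^m$ is (Pompeiu–Hausdorff) continuous if for every $x\in\mathbb{R}^n$ and every $\epsilon>0$ there is $\delta>0$ such that $\mathrm{dist}(S(x),S(x'))\le\epsilon$ for every $x'\in\mathbb{R}^n$ with $\|x'-x\|\le\delta$. It is (Pompeiu–Hausdorff) locally Lipschitz if for every $x\in\mathbb{R}^n$ there are $\delta>0$ and $L>0$ such that $\mathrm{dist}(S(x),S(x'))\le L\|x-x'\|$ for every $x'\in\mathbb{B}_\delta(x)$. It is (globally) Lipschitz if this holds with $\delta\to\infty$; $L$-Lipschitz means $\mathrm{dist}(S(x),S(x'))\le L\|x-x'\|$ for all $x,x'\in\mathbb{R}^n$. For the real-valued functions $f$ (jointly in $(x,y)$) and $\varphi$, continuity and (local) Lipschitz continuity have their usual meaning: locally Lipschitz means Lipschitz on some neighbourhood of each point, and $C$-Lipschitz means Lipschitz with constant $C>0$ on the whole space.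
   Formalization: ''Y* locally Lipschitz'' means the Lipschitz bound for all pairs of points of a ball around x, not only pairs containing x; otherwise (c) fails for g=(y-h(x))^2, h(x)=x^2 sin(1/x^2), h(0)=0, f=y. This strengthens the conclusion of (d). In (e), κ≥0 is stated explicitly. *)

(* Defs.v *)
From HB Require Import structures.
From mathcomp Require Import all_boot all_order all_algebra.
From mathcomp Require Import all_classical all_reals all_analysis.
Set Implicit Arguments.
Unset Strict Implicit.
Unset Printing Implicit Defensive.
Import Order.TTheory GRing.Theory Num.Theory.
Import numFieldNormedType.Exports.
Local Open Scope classical_set_scope.
Local Open Scope ring_scope.

(* The library norm on matrices is the sup norm; the Lipschitz constants below
   refer to the Euclidean one. Topological notions (continuity, compactness,
   neighbourhoods) are the library's, since both norms induce the same
   topology. *)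
Definition eucl_norm (R : realType) (n : nat) (x : 'rV[R]_n) : R :=
  Num.sqrt (\sum_(i < n) x 0 i ^+ 2).

Definition eucl_dist (R : realType) (n : nat) (x x' : 'rV[R]_n) : R :=
  eucl_norm (x - x').

(* R^m x R^n is identified with R^(m + n). *)
Definition eucl_dist_prod (R : realType) (m n : nat)
    (p q : 'rV[R]_m * 'rV[R]_n) : R :=
  eucl_dist (row_mx p.1 p.2) (row_mx q.1 q.2).

(* Extended-real valued, so that it is meaningful for unbounded sets too. *)
Definition hausdorff_dist (R : realType) (n : nat)
    (S1 S2 : set 'rV[R]_n) : \bar R :=
  maxe
    (ereal_sup [set ereal_inf [set (eucl_dist x1 x2)%:E | x2 in S2] | x1 in S1])
    (ereal_sup [set ereal_inf [set (eucl_dist x1 x2)%:E | x1 in S1] | x2 in S2]).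

Section SetValued.
Context (R : realType) (n m : nat).
Implicit Type S : 'rV[R]_n -> set 'rV[R]_m.

Definition ph_continuous S : Prop :=
  forall (x : 'rV[R]_n) (e : R), 0 < e ->
  exists2 d : R, 0 < d & forall x' : 'rV[R]_n, eucl_dist x' x <= d ->
    (hausdorff_dist (S x) (S x') <= e%:E)%E.

(* Both points range over the ball, as for real-valued functions. If one of
   them were kept at the centre x, the property would not pass from argmin g to
   opt_value f g: g(x, y) = (y - x^2 sin(x^-2))^2 and f(x, y) = y on R x R
   have argmin g x = {x^2 sin(x^-2)} and opt_value f g x = x^2 sin(x^-2), which is
   not Lipschitz on any neighbourhood of 0. *)
Definition ph_locally_lipschitz S : Prop :=
  forall x : 'rV[R]_n, exists d L : R, [/\ 0 < d, 0 < L &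
    forall x' x'' : 'rV[R]_n, eucl_dist x' x <= d -> eucl_dist x'' x <= d ->
      (hausdorff_dist (S x') (S x'') <= (L * eucl_dist x' x'')%:E)%E].

Definition ph_lipschitz (L : R) S : Prop :=
  forall x x' : 'rV[R]_n,
    (hausdorff_dist (S x) (S x') <= (L * eucl_dist x x')%:E)%E.

End SetValued.

Section RealValued.
Context (R : realType) (T : topologicalType) (dist : T -> T -> R).

Definition locally_lipschitz (h : T -> R) : Prop :=
  forall x : T, exists2 U : set T, nbhs x U & exists2 L : R, 0 < L &
    forall p q : T, U p -> U q -> `|h p - h q| <= L * dist p q.

Definition lipschitz_const (C : R) (h : T -> R) : Prop :=
  0 < C /\ forall p q : T, `|h p - h q| <= C * dist p q.

End RealValued.

Definition argmin (R : realType) (dx dy : nat)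
    (g : 'rV[R]_dx * 'rV[R]_dy -> R) (x : 'rV[R]_dx) : set 'rV[R]_dy :=
  [set y | forall y' : 'rV[R]_dy, g (x, y) <= g (x, y')].

(* The minimum of A if A has one, and 0 otherwise. *)
Definition set_min (R : realType) (A : set R) : R := xget 0 (A `&` lbound A).

Definition opt_value (R : realType) (dx dy : nat)
    (f g : 'rV[R]_dx * 'rV[R]_dy -> R) (x : 'rV[R]_dx) : R :=
  set_min [set f (x, y) | y in argmin g x].

(* Main.v *)
(* Everything rests on testing [opt_value] against distance functions: for
   f(x, y) = |y0 - y| it is the distance from y0 to argmin g x, and uniform
   Lipschitz bounds in y0 for these distances amount to a Lipschitz bound for
   the Hausdorff distance. Continuity and global Lipschitz continuity follow
   directly, the one-sided estimate at x0 also using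
   f(x, y) = - dist(y, argmin g x0).

   The local Lipschitz converse needs one f that works for all y0, built by a
   gliding hump. If argmin g is not Lipschitz near x0, a geometric chaining
   towards x0 yields pairs (x, x') -> x0 and y in argmin g x such that
   dist(y, argmin g x') and |x - x0| are both much larger than |x - x'|. Let f be
   minus the distance to the complement of a union of balls around sparsely
   chosen (x, y), of radius r about min(dist(y, argmin g x'), |x - x0| / 2):
   it is 1-Lipschitz, while the optimal value is at most -r at x and 0 at x'. *)

Require Import Defs.
From HB Require Import structures.
From mathcomp Require Import all_boot all_order all_algebra.
From mathcomp Require Import all_classical all_reals all_analysis.
From mathcomp Require Import ring lra.
Set Implicit Arguments.
Unset Strict Implicit.
Unset Printing Implicit Defensive.
Import Order.TTheory GRing.Theory Num.Theory.
Import numFieldNormedType.Exports.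
Local Open Scope classical_set_scope.
Local Open Scope ring_scope.

(** * Euclidean norm: Cauchy-Schwarz, triangle inequality, comparison with the sup norm *)

(** Lagrange's identity: twice the gap is the sum over all [i], [j] of the squares of
    [a i * b j - a j * b i]. *)
Lemma sum_mul_sqr_le (R : realType) (n : nat) (a b : 'I_n -> R) :
  (\sum_i a i * b i) ^+ 2 <= (\sum_i a i ^+ 2) * (\sum_i b i ^+ 2).
Proof.
have : 0 <= \sum_i \sum_j (a i * b j - a j * b i) ^+ 2.
  by apply: sumr_ge0 => i _; apply: sumr_ge0 => j _; exact: sqr_ge0.
have -> : \sum_i \sum_j (a i * b j - a j * b i) ^+ 2 =
    ((\sum_i a i ^+ 2) * (\sum_i b i ^+ 2) - (\sum_i a i * b i) ^+ 2) *+ 2.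
  rewrite expr2 mulrnBl mulr2n.
  rewrite {2}[(\sum_i a i ^+ 2) * _]mulrC !big_distrlr -big_split /=.
  rewrite -sumrMnl -sumrB; apply: eq_bigr => i _.
  rewrite -big_split /= -sumrMnl -sumrB; apply: eq_bigr => j _.
  by rewrite mulr2n; ring.
by rewrite pmulrn_lge0 // subr_ge0.
Qed.

Section EuclideanDistance.
Context {R : realType} {n : nat}.
Implicit Types x y z : 'rV[R]_n.

Lemma eucl_norm_ge0 x : 0 <= eucl_norm x. Proof. exact: sqrtr_ge0. Qed.

Lemma eucl_norm_sqr x : eucl_norm x ^+ 2 = \sum_(i < n) x 0 i ^+ 2.
Proof. by rewrite sqr_sqrtr// sumr_ge0// => i _; exact: sqr_ge0. Qed.

Lemma eucl_normD x y : eucl_norm (x + y) <= eucl_norm x + eucl_norm y.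
Proof.
have h := sum_mul_sqr_le (fun i => x 0 i) (fun i => y 0 i).
rewrite -!eucl_norm_sqr -exprMn in h.
have {}h : \sum_i x 0 i * y 0 i <= eucl_norm x * eucl_norm y.
  apply: le_trans (ler_norm _) _.
  rewrite -ler_sqr ?nnegrE ?mulr_ge0 ?eucl_norm_ge0//.
  by rewrite real_normK// num_real.
rewrite -ler_sqr ?nnegrE ?addr_ge0 ?eucl_norm_ge0// sqrrD !eucl_norm_sqr.
under eq_bigr do rewrite mxE sqrrD.
by rewrite !big_split /= lerD2r lerD2l mulr2n lerD.
Qed.

Lemma eucl_normZ (a : R) x : eucl_norm (a *: x) = `|a| * eucl_norm x.
Proof.
rewrite /eucl_norm; under eq_bigr do rewrite mxE exprMn.
by rewrite -mulr_sumr sqrtrM ?sqr_ge0// sqrtr_sqr.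
Qed.

Lemma eucl_norm_eq0 x : eucl_norm x = 0 -> x = 0.
Proof.
move=> x0; have := eucl_norm_sqr x; rewrite x0 expr0n /= => /esym/eqP.
rewrite psumr_eq0 => [|i _]; last exact: sqr_ge0.
move=> /allP xi0; apply/rowP => i; rewrite mxE.
by have := xi0 i (mem_index_enum _); rewrite sqrf_eq0 => /eqP.
Qed.

Lemma eucl_dist_ge0 x y : 0 <= eucl_dist x y. Proof. exact: eucl_norm_ge0. Qed.

Lemma eucl_distC x y : eucl_dist x y = eucl_dist y x.
Proof. by rewrite /eucl_dist -opprB -scaleN1r eucl_normZ normrN1 mul1r. Qed.

Lemma eucl_distxx x : eucl_dist x x = 0.
Proof. by rewrite /eucl_dist subrr -(scale0r 0) eucl_normZ normr0 mul0r. Qed.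

Lemma eucl_dist_eq0 x y : eucl_dist x y = 0 -> x = y.
Proof. by move/eucl_norm_eq0/eqP; rewrite subr_eq0 => /eqP. Qed.

Lemma eucl_distD y x z : eucl_dist x z <= eucl_dist x y + eucl_dist y z.
Proof.
have -> : eucl_dist x z = eucl_norm ((x - y) + (y - z)).
  by rewrite /eucl_dist addrA subrK.
exact: eucl_normD.
Qed.

Lemma normr_le_eucl_norm x : `|x| <= eucl_norm x.
Proof.
rewrite [leLHS]/Num.Def.normr /= mx_normrE; apply: bigmax_le => [|[i j] _ /=].
  exact: eucl_norm_ge0.
rewrite ord1 -ler_sqr ?nnegrE ?eucl_norm_ge0//.
rewrite real_normK ?num_real// eucl_norm_sqr (bigD1 j)//= lerDl.
by apply: sumr_ge0 => k _; exact: sqr_ge0.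
Qed.

Lemma eucl_norm_le_normr x : eucl_norm x <= n%:R * `|x|.
Proof.
have xi_le i : `|x 0 i| <= `|x|.
  rewrite [leRHS]/Num.Def.normr /= mx_normrE; apply/bigmax_geP; right.
  by exists (0, i).
rewrite -ler_sqr ?nnegrE ?mulr_ge0 ?eucl_norm_ge0// eucl_norm_sqr.
apply: (@le_trans _ _ (\sum_(i < n) `|x| ^+ 2)).
  apply: ler_sum => i _; rewrite -[leLHS]real_normK ?num_real//.
  by rewrite ler_sqr ?nnegrE.
rewrite sumr_const card_ord exprMn -[leLHS]mulr_natl ler_wpM2r ?sqr_ge0//.
by rewrite -natrX ler_nat; case: (n) => // m; rewrite -mulnn leq_pmulr.
Qed.

Lemma nbhs_eucl_dist x (A : set 'rV[R]_n) :
  nbhs x A <-> exists2 r : R, 0 < r & forall y, eucl_dist y x <= r -> A y.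
Proof.
split=> [/nbhs_ballP[e /= e0 eA]|[r r0 rA]].
  exists (e / 2); first by rewrite divr_gt0.
  move=> y yx; apply: eA; rewrite -ball_normE /=.
  rewrite distrC (le_lt_trans (normr_le_eucl_norm _))//.
  by rewrite (le_lt_trans yx)// ltr_pdivrMr// ltr_pMr// ltr1n.
(* The added 1 keeps the divisor positive in dimension 0. *)
have n0 : 0 < n%:R + 1 :> R by rewrite ltr_wpDl.
apply/nbhs_ballP; exists (r / (n%:R + 1)); first by rewrite /= divr_gt0.
move=> y; rewrite -ball_normE /= distrC => yx.
apply/rA/(le_trans (eucl_norm_le_normr _)).
apply: (@le_trans _ _ ((n%:R + 1) * `|y - x|)).
  by rewrite ler_wpM2r// lerDl.
by rewrite mulrC -ler_pdivlMr// ltW.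
Qed.

End EuclideanDistance.

(** * Euclidean distance on a product *)

Section EuclideanDistanceProd.
Context {R : realType} {m n : nat}.
Implicit Types p q : 'rV[R]_m * 'rV[R]_n.

Lemma eucl_dist_prod_sqr p q :
  eucl_dist_prod p q ^+ 2 = eucl_dist p.1 q.1 ^+ 2 + eucl_dist p.2 q.2 ^+ 2.
Proof.
rewrite /eucl_dist_prod /eucl_dist opp_row_mx add_row_mx !eucl_norm_sqr.
rewrite big_split_ord /=; congr (_ + _); apply: eq_bigr => i _.
  by rewrite row_mxEl.
by rewrite row_mxEr.
Qed.

Lemma eucl_dist_prod_ge0 p q : 0 <= eucl_dist_prod p q.
Proof. exact: eucl_dist_ge0. Qed.

Lemma eucl_dist_fst_le p q : eucl_dist p.1 q.1 <= eucl_dist_prod p q.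
Proof.
rewrite -ler_sqr ?nnegrE ?eucl_dist_prod_ge0 ?eucl_dist_ge0//.
by rewrite eucl_dist_prod_sqr lerDl sqr_ge0.
Qed.

Lemma eucl_dist_snd_le p q : eucl_dist p.2 q.2 <= eucl_dist_prod p q.
Proof.
rewrite -ler_sqr ?nnegrE ?eucl_dist_prod_ge0 ?eucl_dist_ge0//.
by rewrite eucl_dist_prod_sqr lerDr sqr_ge0.
Qed.

Lemma eucl_dist_prod_le p q :
  eucl_dist_prod p q <= eucl_dist p.1 q.1 + eucl_dist p.2 q.2.
Proof.
rewrite -ler_sqr ?nnegrE ?addr_ge0 ?eucl_dist_prod_ge0 ?eucl_dist_ge0//.
rewrite eucl_dist_prod_sqr sqrrD addrAC lerDl mulrn_wge0//.
by rewrite mulr_ge0 ?eucl_dist_ge0.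
Qed.

Lemma nbhs_eucl_dist_pair p (A : set ('rV[R]_m * 'rV[R]_n)) :
  nbhs p A <-> exists2 r : R, 0 < r & forall q,
    eucl_dist q.1 p.1 <= r -> eucl_dist q.2 p.2 <= r -> A q.
Proof.
split=> [[[/= A1 A2] [/nbhs_eucl_dist[r r0 rA1] /nbhs_eucl_dist[s s0 sA2]] A12]|].
  exists (Num.min r s); first by rewrite lt_min r0.
  move=> q; rewrite !le_min => /andP[q1 _] /andP[_ q2].
  by apply: A12; split=> /=; [exact: rA1|exact: sA2].
case=> r r0 rA.
exists ([set x | eucl_dist x p.1 <= r], [set y | eucl_dist y p.2 <= r]).
  by split; apply/nbhs_eucl_dist; exists r.
by move=> q [] /=; exact: rA.
Qed.

Lemma locally_lipschitz_continuous (f : 'rV[R]_m * 'rV[R]_n -> R) :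
  locally_lipschitz (@eucl_dist_prod R m n) f -> continuous f.
Proof.
move=> fL p; have [U pU [L L0 UL]] := fL p; have Up := nbhs_singleton pU.
apply/cvgrPdist_le => e e0.
have /nbhs_eucl_dist_pair[r r0 rU] := pU.
apply/nbhs_eucl_dist_pair; exists (Num.min r (e / (2 * L))).
  by rewrite lt_min r0 divr_gt0// mulr_gt0.
move=> q; rewrite !le_min => /andP[q1 q1e] /andP[q2 q2e].
apply: le_trans (UL _ _ Up (rU _ q1 q2)) _.
rewrite mulrC -ler_pdivlMr// (le_trans (eucl_dist_prod_le _ _))//.
rewrite eucl_distC [eucl_dist p.2 _]eucl_distC (le_trans (lerD q1e q2e))//.
by rewrite le_eqVlt; apply/orP; left; apply/eqP; field; rewrite gt_eqF.
Qed.

Lemma lipschitz_const_locally (C : R) (f : 'rV[R]_m * 'rV[R]_n -> R) :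
  lipschitz_const (@eucl_dist_prod R m n) C f ->
  locally_lipschitz (@eucl_dist_prod R m n) f.
Proof.
case=> C0 fC p; exists setT; first exact: filterT.
by exists C.
Qed.

End EuclideanDistanceProd.

(** * Compact sets, distance to a set, Hausdorff distance *)

Section CompactSets.
Context {R : realType} {n : nat}.
Implicit Types (x y z : 'rV[R]_n) (A K : set 'rV[R]_n).

(* Lebesgue-number form of compactness. *)
Lemma compact_uniform_radius K (P : R -> 'rV[R]_n -> Prop) :
  compact K -> (forall r s y, 0 < s -> s <= r -> P r y -> P s y) ->
  (forall y, K y -> exists2 r, 0 < r & forall z, eucl_dist z y <= r -> P r z) ->
  exists2 r, 0 < r & forall y, K y -> P r y.
Proof.
move=> /compact_near_coveringP cK Panti Ploc.
(* Compactness is applied to the filter of radii tending to 0 from above; antitonicity in the radius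
   passes from one [r] to all smaller ones. *)
have [|r /= r0 rP] := cK R 0^'+ P _.
  move=> y /Ploc[r r0 rP].
  exists ([set z | eucl_dist z y <= r], [set s | 0 < s <= r]) => /=.
    split; first by apply/nbhs_eucl_dist; exists r.
    near=> s; rewrite /=; apply/andP; split; near: s.
      exact: nbhs_right_gt.
    exact: nbhs_right_le.
  by move=> [z s] /= [zy /andP[s0 sr]]; apply: (Panti r) => //; exact: rP.
exists (r / 2); first by rewrite divr_gt0.
apply: rP; rewrite /= ?divr_gt0//.
by rewrite sub0r normrN gtr0_norm ?divr_gt0// ltr_pdivrMr// ltr_pMr// ltr1n.
Unshelve. all: by end_near. Qed.

Lemma eucl_dist_continuous y : continuous (eucl_dist y).
Proof.
move=> z; apply/(cvgrPdist_le (FF := nbhs_filter z)) => e e0.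
apply/nbhs_eucl_dist; exists e => // w wz.
have := eucl_distD w y z; have := eucl_distD z y w.
rewrite (eucl_distC z w) => h1 h2.
by rewrite ler_norml; apply/andP; split; lra.
Qed.

Lemma compact_eucl_dist_min A y : A !=set0 -> compact A ->
  exists2 a, A a & forall b, A b -> eucl_dist y a <= eucl_dist y b.
Proof.
move=> A0 cA.
have [a aA amin] := compact_EVT_min A0 cA
  (continuous_subspaceT (@eucl_dist_continuous y)).
exists a; first by rewrite inE in aA.
by move=> b Ab; apply: amin; rewrite inE.
Qed.

(** A plain infimum, so that it also covers sets not known to be compact, such as the complement of
    a union of balls. *)
Definition eucl_infdist y A : R := inf [set eucl_dist y a | a in A].

Lemma eucl_infdist_le y A a : A a -> eucl_infdist y A <= eucl_dist y a.
Proof.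
move=> Aa; apply: ge_inf; last by exists a.
by exists 0 => _ [b _ <-]; exact: eucl_dist_ge0.
Qed.

Lemma eucl_infdist_ge y A (c : R) : A !=set0 ->
  (forall a, A a -> c <= eucl_dist y a) -> c <= eucl_infdist y A.
Proof.
move=> [a Aa] Ac; apply: lb_le_inf; first by exists (eucl_dist y a), a.
by move=> _ [b Ab <-]; exact: Ac.
Qed.

Lemma eucl_infdist_eq0 y A : A y -> eucl_infdist y A = 0.
Proof.
move=> Ay; apply/eqP; rewrite eq_le; apply/andP; split.
  by rewrite -(eucl_distxx y); exact: eucl_infdist_le.
by apply: eucl_infdist_ge => [|a _]; [exists y|exact: eucl_dist_ge0].
Qed.

Lemma eucl_infdist_lipschitz A y z : A !=set0 ->
  `|eucl_infdist y A - eucl_infdist z A| <= eucl_dist y z.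
Proof.
move=> A0.
have le_infdist v w : eucl_infdist v A <= eucl_dist v w + eucl_infdist w A.
  rewrite -lerBlDl; apply: eucl_infdist_ge => // a Aa.
  by rewrite lerBlDl (le_trans (eucl_infdist_le _ Aa))// eucl_distD.
have := le_infdist y z; have := le_infdist z y; rewrite (eucl_distC z y) => *.
by rewrite ler_norml; apply/andP; split; lra.
Qed.

(** Nearest points exist by compactness, so the suprema of infima turn into choices of a point
    within [c], without extended reals. *)
Lemma hausdorff_dist_leP (S1 S2 : set 'rV[R]_n) (c : R) :
  S1 !=set0 -> compact S1 -> S2 !=set0 -> compact S2 ->
  (hausdorff_dist S1 S2 <= c%:E)%E <->
  (forall y, S1 y -> exists2 z, S2 z & eucl_dist y z <= c) /\
  (forall z, S2 z -> exists2 y, S1 y & eucl_dist y z <= c).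
Proof.
move=> S10 cS1 S20 cS2; rewrite /hausdorff_dist ge_max; split.
  move=> /andP[h1 h2]; split=> [y S1y|z S2z].
    have [z S2z zmin] := compact_eucl_dist_min y S20 cS2.
    exists z => //; rewrite -lee_fin; apply: le_trans h1.
    apply: le_ereal_sup_tmp; eexists; first by exists y.
    by apply: le_ereal_inf_tmp => _ [w S2w <-]; rewrite lee_fin zmin.
  have [y S1y ymin] := compact_eucl_dist_min z S10 cS1.
  exists y => //; rewrite -lee_fin; apply: le_trans h2.
  apply: le_ereal_sup_tmp; eexists; first by exists z.
  apply: le_ereal_inf_tmp => _ [w S2w <-].
  by rewrite lee_fin eucl_distC [leRHS]eucl_distC ymin.
move=> [h1 h2]; apply/andP; split; apply: ge_ereal_sup => _ [y Sy <-].
  have [z Sz yz] := h1 _ Sy; apply: ge_ereal_inf.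
  by exists (eucl_dist y z)%:E; [exists z|rewrite lee_fin].
have [z Sz yz] := h2 _ Sy; apply: ge_ereal_inf.
by exists (eucl_dist z y)%:E; [exists z|rewrite lee_fin].
Qed.

End CompactSets.

(** * Geometric chaining towards a point *)

Section RadialEstimate.
Context {R : realType} {n : nat} (u : 'rV[R]_n -> R) (x0 : 'rV[R]_n).
Context (d c k : R) (c_gt0 : 0 < c) (k_ge0 : 0 <= k).
Context (u_cont : forall e : R, 0 < e -> exists2 r : R, 0 < r &
  forall x, eucl_dist x x0 <= r -> `|u x - u x0| <= e).
Context (u_lip : forall a b, eucl_dist a x0 <= d -> eucl_dist b x0 <= d ->
  c * eucl_dist a b < eucl_dist a x0 -> u b - u a <= k * eucl_dist a b).

(* The points [x0 + q ^ i (a - x0)] approach [x0] geometrically; for [q] close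
   enough to 1, consecutive ones are close relative to their distance to [x0]. *)
Lemma radial_lipschitz a : eucl_dist a x0 <= d ->
  `|u a - u x0| <= k * eucl_dist a x0.
Proof.
move=> ad; set s := eucl_dist a x0 in ad *.
have [s0|s_neq0] := eqVneq s 0.
  by rewrite (eucl_dist_eq0 s0) subrr normr0 s0 mulr0.
have s_gt0 : 0 < s by rewrite lt_def s_neq0 eucl_dist_ge0.
(* This ratio gives [c * (1 - q) < q]: [c] times the gap between consecutive points is below the
   distance to [x0] of even the nearer one, so [u_lip] applies in both orders. *)
pose q : R := (c + 1) / (c + 2).
have c2 : 0 < c + 2 by rewrite addr_gt0.
have q_gt0 : 0 < q by rewrite divr_gt0// addr_gt0.
have q1E : 1 - q = (c + 2)^-1 by rewrite /q; field; lra.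
have q_lt1 : q < 1 by rewrite -subr_gt0 q1E invr_gt0.
have cq : c * (1 - q) < q.
  by rewrite q1E /q ltr_pM2r ?invr_gt0//; lra.
pose p i := x0 + q ^+ i *: (a - x0).
have px0 i : eucl_dist (p i) x0 = q ^+ i * s.
  rewrite /eucl_dist /p addrC addKr eucl_normZ ger0_norm//.
  by rewrite exprn_ge0 ?ltW.
have pp i : eucl_dist (p i) (p i.+1) = q ^+ i * (1 - q) * s.
  have -> : eucl_dist (p i) (p i.+1) = eucl_norm ((q ^+ i * (1 - q)) *: (a - x0)).
    rewrite /eucl_dist /p; congr eucl_norm.
    by rewrite opprD addrACA subrr add0r -scalerBl exprSr mulrBr mulr1.
  by rewrite eucl_normZ ger0_norm// mulr_ge0 ?subr_ge0 ?exprn_ge0 ?ltW.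
have pd i : eucl_dist (p i) x0 <= d.
  by rewrite px0 (le_trans _ ad)// ler_piMl ?(ltW s_gt0)// exprn_ile1 ?ltW.
have step i : `|u (p i) - u (p i.+1)| <= k * (q ^+ i * (1 - q) * s).
  have qi : 0 < q ^+ i * s by rewrite mulr_gt0// exprn_gt0.
  have h1 := u_lip (pd i) (pd i.+1); have h2 := u_lip (pd i.+1) (pd i).
  rewrite (eucl_distC (p i.+1)) !pp !px0 exprSr in h1 h2.
  have eqq : c * (q ^+ i * (1 - q) * s) = (c * (1 - q)) * (q ^+ i * s) by ring.
  rewrite ler_norml; apply/andP; split.
    have : u (p i.+1) - u (p i) <= k * (q ^+ i * (1 - q) * s).
      by apply: h1; rewrite eqq gtr_pMl//; lra.
    by lra.
  by apply: h2; rewrite eqq [_ * q]mulrC -[ltRHS]mulrA ltr_pM2r.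
have tele i : `|u a - u (p i)| <= k * ((1 - q ^+ i) * s).
  elim: i => [|i IH].
    by rewrite /p expr0 scale1r (addrC x0) subrK !subrr normr0 mul0r mulr0.
  have -> : u a - u (p i.+1) = (u a - u (p i)) + (u (p i) - u (p i.+1)) by ring.
  rewrite (le_trans (ler_normD _ _))// (le_trans (lerD IH (step i)))//.
  rewrite exprSr -mulrDr -mulrDl le_eqVlt.
  by apply/orP; left; apply/eqP; ring.
(* The chain reaches [x0] only in the limit; continuity at [x0] bounds the remaining piece by
   [e]. *)
apply/ler_addgt0Pr => e e0; have [r r0 ur] := u_cont e0.
have [i qi] : exists i, q ^+ i * s <= r.
  have /cvgrPdist_le/(_ (r / s)) : (fun i => q ^+ i) @ \oo --> (0 : R).
    by apply: cvg_expr; rewrite gtr0_norm.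
  rewrite divr_gt0// => /(_ isT)[N _ /(_ N)/=]; rewrite leqnn => /(_ isT).
  rewrite sub0r normrN ger0_norm ?(exprn_ge0 _ (ltW q_gt0))// ler_pdivlMr// => h.
  by exists N.
have -> : u a - u x0 = (u a - u (p i)) + (u (p i) - u x0) by ring.
rewrite (le_trans (ler_normD _ _))// lerD//; last by apply: ur; rewrite px0.
rewrite (le_trans (tele i))// ler_wpM2l//.
by rewrite ler_piMl ?(ltW s_gt0)// gerBl exprn_ge0// ltW.
Qed.

(** Either the pair is close relative to its distance to [x0] and [u_lip] applies, or the path
    through [x0] has length at most [2 * c + 1] times [eucl_dist a b]. *)
Lemma radial_to_lipschitz a b : eucl_dist a x0 <= d -> eucl_dist b x0 <= d ->
  u b - u a <= k * (2 * c + 1) * eucl_dist a b.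
Proof.
move=> ad bd; have ab0 := eucl_dist_ge0 a b; have c0 := c_gt0.
have [/(u_lip ad bd) h|h] := ltP (c * eucl_dist a b) (eucl_dist a x0).
  apply: le_trans h _; rewrite -mulrA ler_wpM2l// ler_peMl//; lra.
have := radial_lipschitz ad; have := radial_lipschitz bd.
rewrite !ler_norml => /andP[_ hb] /andP[ha _].
have hd := eucl_distD a b x0; rewrite (eucl_distC b a) in hd.
have : k * (eucl_dist a x0 + eucl_dist b x0) <= k * ((2 * c + 1) * eucl_dist a b).
  rewrite ler_wpM2l//; lra.
rewrite mulrDr mulrA; lra.
Qed.

End RadialEstimate.

(** * Attainment of the optimal value, and distances to the argmin sets as optimal values *)

Section OptValue.
Context {R : realType} {dx dy : nat} (g : 'rV[R]_dx * 'rV[R]_dy -> R).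
Context (hY : forall x, argmin g x !=set0 /\ compact (argmin g x)).
Implicit Types (x : 'rV[R]_dx) (y z : 'rV[R]_dy).
Implicit Types f : 'rV[R]_dx * 'rV[R]_dy -> R.

(** A continuous function attains its minimum on the compact argmin set, so the default 0 of
    [set_min] never occurs. *)
Lemma opt_valueP f x : continuous f ->
  exists2 y, argmin g x y & opt_value f g x = f (x, y) /\
    forall y', argmin g x y' -> f (x, y) <= f (x, y').
Proof.
move=> fc; have [S0 cS] := hY x.
have fxc : continuous (fun y => f (x, y)).
  move=> y; apply/(cvgrPdist_le (FF := nbhs_filter y)) => e e0.
  have /cvgrPdist_le/(_ e e0)/nbhs_eucl_dist_pair[r r0 fr] := fc (x, y).
  apply/nbhs_eucl_dist; exists r => // z zy; apply: fr => //=.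
  by rewrite eucl_distxx ltW.
have [y yS ymin] := compact_EVT_min S0 cS (continuous_subspaceT fxc).
rewrite inE in yS.
have {}ymin y' : argmin g x y' -> f (x, y) <= f (x, y').
  by move=> y'S; apply: ymin; rewrite inE.
exists y => //; split=> //; apply: xget_unique.
  by split; [exists y|move=> _ [z zS <-]; exact: ymin].
move=> _ [[z zS <-] zmin]; apply/eqP; rewrite eq_le ymin// andbT.
by apply: zmin; exists y.
Qed.

Lemma opt_value_le f x y : continuous f -> argmin g x y ->
  opt_value f g x <= f (x, y).
Proof. by move=> fc yS; have [z _ [-> zmin]] := opt_valueP x fc; exact: zmin. Qed.

Lemma hausdorff_argmin_leP x x' (c : R) :
  (hausdorff_dist (argmin g x) (argmin g x') <= c%:E)%E <->
  (forall y, argmin g x y -> exists2 z, argmin g x' z & eucl_dist y z <= c) /\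
  (forall z, argmin g x' z -> exists2 y, argmin g x y & eucl_dist y z <= c).
Proof.
by have [? ?] := hY x; have [? ?] := hY x'; exact: hausdorff_dist_leP.
Qed.

(** The factor [C] adapts the test function to the constant prescribed in the global converse. *)
Lemma eucl_dist_snd_lipschitz (C : R) y : 0 < C ->
  lipschitz_const (@eucl_dist_prod R dx dy) C (fun p => C * eucl_dist y p.2).
Proof.
move=> C0; split=> // p q.
rewrite -mulrBr normrM gtr0_norm// ler_wpM2l ?(ltW C0)//.
apply: le_trans (eucl_dist_snd_le p q).
have := eucl_distD p.2 y q.2; have := eucl_distD q.2 y p.2.
rewrite (eucl_distC q.2) => h1 h2.
by rewrite ler_norml; apply/andP; split; lra.
Qed.

(** Written as an optimal value rather than an infimum, so that hypotheses on [opt_value] apply to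
    it directly. *)
Definition dist_argmin y x : R :=
  opt_value (fun p : 'rV[R]_dx * 'rV[R]_dy => eucl_dist y p.2) g x.

Lemma eucl_dist_snd_locally_lipschitz y :
  locally_lipschitz (@eucl_dist_prod R dx dy) (fun p => eucl_dist y p.2).
Proof.
have := lipschitz_const_locally (eucl_dist_snd_lipschitz y ltr01).
by under [X in locally_lipschitz _ X -> _]eq_fun do rewrite mul1r.
Qed.

Lemma eucl_dist_snd_continuous y :
  continuous (fun p : 'rV[R]_dx * 'rV[R]_dy => eucl_dist y p.2).
Proof.
exact: locally_lipschitz_continuous (eucl_dist_snd_locally_lipschitz y).
Qed.

Lemma dist_argminP y x : exists2 z, argmin g x z & dist_argmin y x = eucl_dist y z.
Proof.
by have [z zS [ez _]] := opt_valueP x (eucl_dist_snd_continuous (y := y)); exists z.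
Qed.

Lemma dist_argmin_le y x z : argmin g x z -> dist_argmin y x <= eucl_dist y z.
Proof. exact: opt_value_le (eucl_dist_snd_continuous (y := y)). Qed.

Lemma dist_argmin_ge0 y x : 0 <= dist_argmin y x.
Proof. by have [z _ ->] := dist_argminP y x; exact: eucl_dist_ge0. Qed.

Lemma dist_argmin0 y x : argmin g x y -> dist_argmin y x = 0.
Proof.
move=> yS; apply/eqP; rewrite eq_le dist_argmin_ge0 andbT.
by rewrite -(eucl_distxx y) dist_argmin_le.
Qed.

Lemma dist_argminD z y x : dist_argmin y x <= eucl_dist y z + dist_argmin z x.
Proof.
have [w wS ->] := dist_argminP z x.
by apply: le_trans (eucl_distD z _ _); exact: dist_argmin_le.
Qed.

(** At a point [y] of one set its own distance term vanishes, so the bound places a point of the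
    other set within [c] of [y]. *)
Lemma hausdorff_argmin_le x x' (c : R) :
  (forall y, dist_argmin y x' - dist_argmin y x <= c) ->
  (forall y, dist_argmin y x - dist_argmin y x' <= c) ->
  (hausdorff_dist (argmin g x) (argmin g x') <= c%:E)%E.
Proof.
move=> h1 h2; apply/hausdorff_argmin_leP; split=> [y yS|y yS].
  have [z zS ez] := dist_argminP y x'; exists z => //.
  by have := h1 y; rewrite (dist_argmin0 yS) subr0 ez.
have [z zS ez] := dist_argminP y x; exists z => //.
by have := h2 y; rewrite (dist_argmin0 yS) subr0 ez eucl_distC.
Qed.

(** * Continuity, in both directions *)

Lemma opt_value_continuous f : continuous f -> ph_continuous (argmin g) ->
  continuous (opt_value f g).
Proof.
move=> fc Sc x; apply/(cvgrPdist_le (FF := nbhs_filter x)) => e e0.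
have [||r r0 fr] := @compact_uniform_radius _ _ (argmin g x) (fun r y =>
    forall x' y', eucl_dist x' x <= r -> eucl_dist y' y <= r ->
    `|f (x, y) - f (x', y')| <= e) (hY x).2.
- by move=> r s y _ sr rP x' y' xs ys; apply: rP; exact: le_trans sr.
- move=> y _; have /cvgrPdist_le/(_ (e / 2)) := fc (x, y).
  rewrite divr_gt0// => /(_ isT)/nbhs_eucl_dist_pair[r r0 fr].
  exists (r / 2); first by rewrite divr_gt0.
  move=> z zy x' y' xr yr.
  have h1 : `|f (x, y) - f (x, z)| <= e / 2.
    by apply: fr => /=; [rewrite eucl_distxx ltW|lra].
  have h2 : `|f (x, y) - f (x', y')| <= e / 2.
    apply: fr => /=; first by lra.
    by have := eucl_distD z y' y; lra.
  move: h1 h2; rewrite !ler_norml => /andP[? ?] /andP[? ?].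
  by apply/andP; split; lra.
have [d d0 Sd] := Sc x r r0.
apply/nbhs_eucl_dist; exists (Num.min r d); first by rewrite lt_min r0.
move=> x'; rewrite le_min => /andP[xr /Sd /hausdorff_argmin_leP[S1 S2]].
(* Each minimiser is moved to a nearby point of the other argmin set: [z] bounds the value at [x']
   from above, [z'] the value at [x]. *)
have [y yS [ey _]] := opt_valueP x fc; have [y' y'S [ey' _]] := opt_valueP x' fc.
have [z zS yz] := S1 y yS; have [z' z'S yz'] := S2 y' y'S.
have hz := opt_value_le fc zS; have hz' := opt_value_le fc z'S.
rewrite eucl_distC in yz; rewrite eucl_distC in yz'.
have := fr y yS x' z xr yz; have := fr z' z'S x' y' xr yz'.
by rewrite !ler_norml => /andP[? ?] /andP[? ?]; apply/andP; split; lra.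
Qed.

Lemma argmin_continuous :
  (forall f, continuous f -> continuous (opt_value f g)) ->
  ph_continuous (argmin g).
Proof.
move=> H x e e0.
have cont f : locally_lipschitz (@eucl_dist_prod R dx dy) f ->
    forall t : R, 0 < t -> exists2 r, 0 < r & forall x', eucl_dist x' x <= r ->
    `|opt_value f g x - opt_value f g x'| <= t.
  move=> /locally_lipschitz_continuous/H/(_ x) fx t t0.
  by have /(cvgrPdist_le (FF := nbhs_filter x))/(_ t t0)/nbhs_eucl_dist := fx.
(* Points of [argmin g x'] are not confined beforehand to a compact set, so one function must handle
   all of them: its optimal value is 0 at [x] and at most minus the distance from [z] to
   [argmin g x] at [x']. *)
pose f (p : 'rV[R]_dx * 'rV[R]_dy) := - eucl_infdist p.2 (argmin g x).
have fL : locally_lipschitz (@eucl_dist_prod R dx dy) f.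
  apply: (@lipschitz_const_locally _ _ _ 1); split=> // p q; rewrite mul1r.
  rewrite /f -opprD normrN (le_trans (eucl_infdist_lipschitz _ _ (hY x).1))//.
  exact: eucl_dist_snd_le.
have fc := locally_lipschitz_continuous fL.
have [r r0 fr] := cont f fL e e0.
have [||s s0 us] := @compact_uniform_radius _ _ (argmin g x) (fun s y =>
    forall x', eucl_dist x' x <= s -> dist_argmin y x' <= e) (hY x).2.
- by move=> s t y _ ts sP x' x't; apply: sP; exact: le_trans ts.
(* Half of [e] pays for moving [x] to [x'], the other half for moving [y] to [z]. *)
- move=> y yS; have [s s0 us] := cont _ (eucl_dist_snd_locally_lipschitz y)
    (e / 2) (divr_gt0 e0 (ltr0n _ 2)).
  exists (Num.min s (e / 2)); first by rewrite lt_min s0 divr_gt0.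
  move=> z; rewrite le_min => /andP[_ zy] x'; rewrite le_min => /andP[xs _].
  have := us x' xs; rewrite -!/(dist_argmin _ _) (dist_argmin0 yS) sub0r normrN.
  by rewrite ger0_norm ?dist_argmin_ge0//; have := dist_argminD y z x'; lra.
exists (Num.min r s); first by rewrite lt_min r0.
move=> x'; rewrite le_min => /andP[xr xs].
apply/hausdorff_argmin_leP; split=> [y yS|z zS].
  have [z zS ez] := dist_argminP y x'.
  by exists z => //; rewrite -ez us.
have [y yS ymin] := compact_eucl_dist_min z (hY x).1 (hY x).2.
exists y => //; rewrite eucl_distC.
apply: le_trans (eucl_infdist_ge (hY x).1 ymin) _.
have := opt_value_le fc zS; rewrite {2}/f /= => hz.
have [w wS [ew _]] := opt_valueP x fc.
have := fr x' xr; rewrite ew {1}/f /= eucl_infdist_eq0// oppr0 sub0r normrN.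
by rewrite ler_norml => /andP[? ?]; lra.
Qed.

(** * Local Lipschitz continuity of the optimal value *)

Lemma opt_value_locally_lipschitz f :
  locally_lipschitz (@eucl_dist_prod R dx dy) f ->
  ph_locally_lipschitz (argmin g) ->
  locally_lipschitz (@eucl_dist R dx) (opt_value f g).
Proof.
move=> fL SL x; have fc := locally_lipschitz_continuous fL.
have [d [L [d0 L0 SdL]]] := SL x.
(* One parameter encodes both radius and Lipschitz constant [r^-1]: shrinking [r] weakens both
   requirements, as the compactness lemma demands. *)
have [||r r0 fr] := @compact_uniform_radius _ _ (argmin g x) (fun r y =>
    forall x' x'' y' y'', eucl_dist x' x <= r -> eucl_dist x'' x <= r ->
    eucl_dist y' y <= r -> eucl_dist y'' y <= r ->
    `|f (x', y') - f (x'', y'')| <=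
      r^-1 * eucl_dist_prod (x', y') (x'', y'')) (hY x).2.
- move=> r s y s0 sr rP x' x'' y' y'' h1 h2 h3 h4.
  apply: le_trans (rP _ _ _ _ _ _ _ _) _; try exact: le_trans sr.
  rewrite ler_wpM2r ?eucl_dist_prod_ge0// lef_pV2 ?posrE//.
  exact: lt_le_trans sr.
- move=> y _; have [U /nbhs_eucl_dist_pair[r r0 rU] [M M0 fM]] := fL (x, y).
  exists (Num.min (r / 2) M^-1); first by rewrite lt_min divr_gt0// invr_gt0.
  move=> z; rewrite le_min => /andP[zy _] x' x'' y' y''.
  rewrite !le_min => /andP[? _] /andP[? _] /andP[? _] /andP[? _].
  have Mr : M <= (Num.min (r / 2) M^-1)^-1.
    rewrite -[leLHS]invrK lef_pV2 ?posrE ?lt_min ?invr_gt0 ?divr_gt0//.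
    by rewrite ge_min lexx orbT.
  apply: le_trans (ler_wpM2r (eucl_dist_prod_ge0 _ _) Mr).
  apply: fM; apply: rU => /=; try lra.
    by have := eucl_distD z y' y; lra.
  by have := eucl_distD z y'' y; lra.
(* With [r / (3 * L)], [y'] is within [r / 3] of a point [y] of [argmin g x], and [y''] within
   [2 * r / 3] of [y'], so both stay within [r] of [y]. *)
pose t := Num.min d (Num.min r (r / (3 * L))).
have t0 : 0 < t by rewrite !lt_min d0 r0 divr_gt0// mulr_gt0.
exists [set x' | eucl_dist x' x <= t]; first by apply/nbhs_eucl_dist; exists t.
exists (r^-1 * (1 + L)); first by rewrite mulr_gt0 ?invr_gt0 ?addr_gt0.
have half x' x'' : eucl_dist x' x <= t -> eucl_dist x'' x <= t ->
    opt_value f g x'' - opt_value f g x' <= r^-1 * (1 + L) * eucl_dist x' x''.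
  rewrite !le_min => /andP[d1 /andP[r1 l1]] /andP[d2 /andP[r2 l2]].
  have [y' y'S [-> _]] := opt_valueP x' fc.
  have xd : eucl_dist x x <= d by rewrite eucl_distxx ltW.
  have [/(_ _ y'S)[y yS yy'] _] :=
    (hausdorff_argmin_leP _ _ _).1 (SdL _ _ d1 xd).
  have [/(_ _ y'S)[y'' y''S yy''] _] :=
    (hausdorff_argmin_leP _ _ _).1 (SdL _ _ d1 d2).
  have xx : eucl_dist x' x'' <= eucl_dist x' x + eucl_dist x'' x.
    by rewrite (eucl_distC x'' x) eucl_distD.
  have L3 : 0 < 3 * L by rewrite mulr_gt0.
  rewrite ler_pdivlMr// in l1; rewrite ler_pdivlMr// in l2.
  have Lxx := ler_wpM2l (ltW L0) xx.
  have Lx := mulr_ge0 (ltW L0) (eucl_dist_ge0 x' x).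
  have Lx' := mulr_ge0 (ltW L0) (eucl_dist_ge0 x'' x).
  have y'r : eucl_dist y' y <= r by lra.
  have y''r : eucl_dist y'' y <= r.
    have := eucl_distD y' y'' y; rewrite (eucl_distC y'' y'); lra.
  have := fr y yS x' x'' y' y'' r1 r2 y'r y''r.
  have := opt_value_le fc y''S.
  have := eucl_dist_prod_le (x', y') (x'', y''); rewrite /= => hp.
  have : r^-1 * eucl_dist_prod (x', y') (x'', y'') <=
      r^-1 * ((1 + L) * eucl_dist x' x'').
    by rewrite ler_wpM2l ?invr_ge0 ?(ltW r0)//; lra.
  by rewrite ler_norml mulrA => ? ? /andP[? ?]; lra.
move=> p q /= pt qt; have := half _ _ pt qt; have := half _ _ qt pt.
by rewrite (eucl_distC q) ler_norml => ? ?; apply/andP; split; lra.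
Qed.

(** * Global Lipschitz continuity, in both directions *)

(** Following a minimiser from [x] to [x'] costs [eucl_dist x x'] in the first variable and [kappa]
    times that in the second, whence [kappa + 1]. *)
Lemma opt_value_lipschitz f (Cf kappa : R) : 0 <= kappa ->
  lipschitz_const (@eucl_dist_prod R dx dy) Cf f ->
  ph_lipschitz kappa (argmin g) ->
  lipschitz_const (@eucl_dist R dx) ((kappa + 1) * Cf) (opt_value f g).
Proof.
move=> k0 fL SL.
have fc := locally_lipschitz_continuous (lipschitz_const_locally fL).
have [C0 fC] := fL; split; first by rewrite mulr_gt0// ltr_wpDl.
have half x x' :
    opt_value f g x' - opt_value f g x <= (kappa + 1) * Cf * eucl_dist x x'.
  have [y yS [-> _]] := opt_valueP x fc.
  have [/(_ _ yS)[y' y'S yy'] _] := (hausdorff_argmin_leP _ _ _).1 (SL x x').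
  have := fC (x, y) (x', y'); have := opt_value_le fc y'S.
  have := eucl_dist_prod_le (x, y) (x', y'); rewrite /= => hp.
  have : Cf * eucl_dist_prod (x, y) (x', y') <=
      Cf * ((kappa + 1) * eucl_dist x x').
    by rewrite ler_wpM2l ?(ltW C0)//; lra.
  by rewrite ler_norml mulrA (mulrC Cf) => ? ? /andP[? ?]; lra.
move=> p q; have := half p q; have := half q p.
by rewrite (eucl_distC q) ler_norml => ? ?; apply/andP; split; lra.
Qed.

Lemma opt_valueZ f (C : R) x : 0 < C -> continuous f ->
  opt_value (fun p => C * f p) g x = C * opt_value f g x.
Proof.
move=> C0 fc; have [y yS [-> ymin]] := opt_valueP x fc.
apply: xget_unique; first split; first by exists y.
  by move=> _ [z zS <-]; rewrite ler_pM2l// ymin.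
move=> _ [[z zS <-] zmin]; apply/eqP; rewrite eq_le; apply/andP; split.
  by apply: zmin; exists y.
by rewrite ler_pM2l// ymin.
Qed.

Lemma argmin_lipschitz (Cf Cphi : R) : 0 < Cf ->
  (forall f, lipschitz_const (@eucl_dist_prod R dx dy) Cf f ->
    lipschitz_const (@eucl_dist R dx) Cphi (opt_value f g)) ->
  ph_lipschitz (Cphi / Cf) (argmin g).
Proof.
move=> C0 H x x'.
have hu y : `|dist_argmin y x - dist_argmin y x'| <=
    Cphi / Cf * eucl_dist x x'.
  have [_ /(_ x x')] := H _ (eucl_dist_snd_lipschitz y C0).
  rewrite !opt_valueZ//; try exact: eucl_dist_snd_continuous.
  rewrite -mulrBr normrM gtr0_norm// -ler_pdivlMl// => h.
  by rewrite mulrAC [leRHS]mulrC.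
by apply: hausdorff_argmin_le => y; have := hu y;
  rewrite ler_norml => /andP[? ?]; lra.
Qed.

(** * Local Lipschitz continuity of the argmin map *)

(* The last bound keeps [x0] far away compared with the gap between [x] and
   [x'], so that a steep pair can be treated independently of [x0]. *)
Definition steep_pair x0 (k d : R) (t : 'rV[R]_dx * 'rV[R]_dx * 'rV[R]_dy) :=
  let: (x, x', y) := t in
  [/\ eucl_dist x x0 <= d, eucl_dist x' x0 <= d, argmin g x y,
      k * eucl_dist x x' < dist_argmin y x' &
      2 * k * eucl_dist x x' < eucl_dist x x0].

(** Without steep pairs, every [dist_argmin y] satisfies the radial estimate with [c = 2 * k], with
    a constant independent of [y]. *)
Lemma not_lipschitz_steep_pair x0 :
  (forall f, locally_lipschitz (@eucl_dist_prod R dx dy) f ->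
    locally_lipschitz (@eucl_dist R dx) (opt_value f g)) ->
  ~ (exists d L : R, [/\ 0 < d, 0 < L &
    forall x' x'', eucl_dist x' x0 <= d -> eucl_dist x'' x0 <= d ->
      (hausdorff_dist (argmin g x') (argmin g x'') <=
       (L * eucl_dist x' x'')%:E)%E]) ->
  forall k d : R, 0 < k -> 0 < d -> exists t, steep_pair x0 k d t.
Proof.
move=> H nL k d k0 d0; apply: contrapT => nsteep; apply: nL.
exists d, (k * (2 * (2 * k) + 1)); split=> //.
  by rewrite mulr_gt0// addr_gt0// !mulr_gt0.
have hu y a b : eucl_dist a x0 <= d -> eucl_dist b x0 <= d ->
    dist_argmin y b - dist_argmin y a <= k * (2 * (2 * k) + 1) * eucl_dist a b.
  apply: radial_to_lipschitz => [||e e0|]; [exact: mulr_gt0|exact: ltW| |].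
    (* Here [r] and [L] depend on [y], but they only serve continuity at [x0] and do not enter the
       final constant. *)
    have [U /nbhs_eucl_dist[r r0 rU] [L L0 UL]] :=
      H _ (eucl_dist_snd_locally_lipschitz y) x0.
    exists (Num.min r (e / L)); first by rewrite lt_min r0 divr_gt0.
    move=> x; rewrite le_min => /andP[xr xe].
    apply: le_trans (UL _ _ (rU _ xr) (rU _ _)) _.
      by rewrite eucl_distxx ltW.
    by rewrite mulrC -ler_pdivlMr.
  move=> {}a {}b ad bd ab; rewrite leNgt; apply/negP => steep; apply: nsteep.
  (* Replacing [y] by its nearest point [z] in [argmin g a] keeps the steepness, by the triangle
     inequality. *)
  have [z zS ez] := dist_argminP y a.
  exists (a, b, z); split=> //; apply: lt_le_trans steep _.
  by rewrite ez lerBlDl; exact: dist_argminD.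
by move=> a b ad bd; apply: hausdorff_argmin_le => y;
  [|rewrite eucl_distC]; exact: hu.
Qed.

Lemma argmin_locally_lipschitz :
  (forall f, locally_lipschitz (@eucl_dist_prod R dx dy) f ->
    locally_lipschitz (@eucl_dist R dx) (opt_value f g)) ->
  ph_locally_lipschitz (argmin g).
Proof.
move=> H x0; apply: contrapT => /(not_lipschitz_steep_pair H) steep.
(* Choosing for all indices and radii at once lets the recursion fix each radius after the previous
   pair; the bound [jd.1.+1%:R^-1] forces convergence to [x0], and [(x0, x0, 0)] is a dummy for
   non-positive radii. *)
have /choice[F FP] (jd : nat * R) : exists t,
    0 < jd.2 -> steep_pair x0 jd.1.+1%:R (Num.min jd.2 jd.1.+1%:R^-1) t.
  have [d0|_] := ltP 0 jd.2; last by exists (x0, x0, 0).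
  have [||t tP] := steep jd.1.+1%:R (Num.min jd.2 jd.1.+1%:R^-1) => //.
    by rewrite lt_min d0 invr_gt0 ltr0n.
  by exists t.
pose s (t : 'rV[R]_dx * 'rV[R]_dx * 'rV[R]_dy) := eucl_dist t.1.1 x0.
(* The divisor 4 makes the distances of the [X j] to [x0] drop by that factor, which separates the
   annuli. *)
pose delta := fix delta (j : nat) : R :=
  if j is i.+1 then s (F (i, delta i)) / 4 else 1.
pose X j := (F (j, delta j)).1.1; pose X' j := (F (j, delta j)).1.2.
pose Y j := (F (j, delta j)).2.
have delta_steep j : 0 < delta j ->
    steep_pair x0 j.+1%:R (Num.min (delta j) j.+1%:R^-1) (X j, X' j, Y j).
  by move=> /(FP (j, delta j)); rewrite /X /X' /Y; case: (F _) => [[]].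
have k_ge1 j : 1 <= j.+1%:R :> R by rewrite ler1n.
have delta_gt0 j : 0 < delta j.
  elim: j => [|j /delta_steep[_ _ _ _ h]] /=; first exact: ltr01.
  rewrite divr_gt0//; apply: le_lt_trans h.
  by rewrite !mulr_ge0// eucl_dist_ge0.
have {delta_steep}XP j := delta_steep j (delta_gt0 j).
have gap j : 2 * eucl_dist (X j) (X' j) < eucl_dist (X j) x0.
  have [_ _ _ _ h] := XP j; apply: le_lt_trans h.
  by rewrite ler_wpM2r ?eucl_dist_ge0// ler_peMr.
have X_gt0 j : 0 < eucl_dist (X j) x0.
  by apply: le_lt_trans (gap j); rewrite mulr_ge0// eucl_dist_ge0.
have X_decr i j : (i < j)%N -> 4 * eucl_dist (X j) x0 <= eucl_dist (X i) x0.
  have dec1 m : 4 * eucl_dist (X m.+1) x0 <= eucl_dist (X m) x0.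
    have [h _ _ _ _] := XP m.+1; move: h; rewrite le_min => /andP[h _].
    by rewrite mulrC -ler_pdivlMr.
  elim: j => // j IH; rewrite ltnS leq_eqVlt => /orP[/eqP->//|/IH h].
  by apply: le_trans (dec1 j) _; have := X_gt0 j; lra.
pose r j := Num.min (dist_argmin (Y j) (X' j)) (eucl_dist (X j) x0 / 2).
have r_le j : r j <= eucl_dist (X j) x0 / 2 by rewrite ge_min lexx orbT.
have gap_r j : j.+1%:R * eucl_dist (X j) (X' j) < r j.
  have [_ _ _ h1 h2] := XP j; rewrite lt_min h1 /=.
  by rewrite ltr_pdivlMr// mulrC mulrA.
have XX' j := eucl_dist_ge0 (X j) (X' j).
(* [f] is minus the distance to the complement of the union of the balls of
   radius [r j] around [(X j, Y j)]; these balls lie over disjoint annuli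
   around [x0], hence [f] vanishes on [{X' j} * argmin g (X' j)]. *)
pose Z := [set z | forall j, r j <= eucl_dist z (row_mx (X j) (Y j))].
pose f (p : 'rV[R]_dx * 'rV[R]_dy) := - eucl_infdist (row_mx p.1 p.2) Z.
have pZ x y : (forall j, r j <= eucl_dist_prod (x, y) (X j, Y j)) ->
    Z (row_mx x y) by [].
have Z0 : Z !=set0.
  exists (row_mx x0 (0 : 'rV[R]_dy)); apply: pZ => j.
  apply: le_trans (eucl_dist_fst_le _ _); rewrite /= eucl_distC.
  by have := r_le j; have := X_gt0 j; lra.
have fL : locally_lipschitz (@eucl_dist_prod R dx dy) f.
  apply: (@lipschitz_const_locally _ _ _ 1); split=> // p q; rewrite mul1r.
  by rewrite /f -opprD normrN; exact: eucl_infdist_lipschitz.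
have fc := locally_lipschitz_continuous fL.
have phiX j : opt_value f g (X j) <= - r j.
  have [_ _ YS _ _] := XP j; apply: le_trans (opt_value_le fc YS) _.
  by rewrite lerN2; apply: eucl_infdist_ge => // z Zz; rewrite eucl_distC.
have phiX' j : 0 <= opt_value f g (X' j).
  have [y yS [-> _]] := opt_valueP (X' j) fc.
  rewrite /f /= eucl_infdist_eq0 ?oppr0//; apply: pZ => i.
  have h1 := eucl_distD (X' j) (X j) x0; have h2 := eucl_distD (X j) (X' j) x0.
  rewrite (eucl_distC (X' j) (X j)) in h2.
  have h3 := eucl_distD (X' j) (X i) x0; have h4 := eucl_distD (X i) (X' j) x0.
  rewrite (eucl_distC (X i) (X' j)) in h3.
  have hi := r_le i; have hj := gap j; have hXj := X_gt0 j; have hXi := X_gt0 i.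
  (* By [gap], the distance from [X' j] to [x0] is between 1/2 and 3/2 of that of [X j], so for [i]
     other than [j] the first coordinates are far enough apart; for [i = j] the second ones are, by
     [dist_argmin]. *)
  have [ij|ji|->] := ltngtP i j.
  - apply: le_trans (eucl_dist_fst_le _ _) => /=.
    by have := X_decr _ _ ij; lra.
  - apply: le_trans (eucl_dist_fst_le _ _) => /=.
    by have := X_decr _ _ ji; lra.
  apply: le_trans (eucl_dist_snd_le _ _) => /=; rewrite eucl_distC.
  by rewrite ge_min; apply/orP; left; exact: dist_argmin_le.
have [U /nbhs_eucl_dist[d d0 dU] [L L0 UL]] := H f fL x0.
(* For this [j] both points lie in [U] and [L < j.+1%:R], so [r j] is at most
   [L * eucl_dist (X j) (X' j)], against [gap_r]. *)
pose j := Num.truncn (Num.max L d^-1).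
have hj : Num.max L d^-1 < j.+1%:R.
  by rewrite truncnS_gt.
move: hj; rewrite gt_max => /andP[Lj dj].
have jd : j.+1%:R^-1 <= d.
  by rewrite -[leRHS]invrK lef_pV2 ?posrE ?invr_gt0// ltW.
have [hX hX' _ _ _] := XP j; move: hX hX'.
rewrite !le_min => /andP[_ hX] /andP[_ hX'].
have := UL _ _ (dU _ (le_trans hX jd)) (dU _ (le_trans hX' jd)).
have := ler_wpM2r (XX' j) (ltW Lj).
have := gap_r j; have := phiX j; have := phiX' j.
by rewrite ler_norml => ? ? ? ? /andP[? ?]; lra.
Qed.

End OptValue.

Theorem theorem3p1 (R : realType) (dx dy : nat)
    (g : 'rV[R]_dx * 'rV[R]_dy -> R)
    (hY : forall x : 'rV[R]_dx, argmin g x !=set0 /\ compact (argmin g x)) :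
  (* (a) *)
  (forall f : 'rV[R]_dx * 'rV[R]_dy -> R,
     continuous f -> ph_continuous (argmin g) -> continuous (opt_value f g)) /\
  (* (b) *)
  ((forall f : 'rV[R]_dx * 'rV[R]_dy -> R,
      continuous f -> continuous (opt_value f g)) ->
   ph_continuous (argmin g)) /\
  (* (c) *)
  (forall f : 'rV[R]_dx * 'rV[R]_dy -> R,
     locally_lipschitz (@eucl_dist_prod R dx dy) f ->
     ph_locally_lipschitz (argmin g) ->
     locally_lipschitz (@eucl_dist R dx) (opt_value f g)) /\
  (* (d) *)
  ((forall f : 'rV[R]_dx * 'rV[R]_dy -> R,
      locally_lipschitz (@eucl_dist_prod R dx dy) f ->
      locally_lipschitz (@eucl_dist R dx) (opt_value f g)) ->
   ph_locally_lipschitz (argmin g)) /\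
  (* (e) *)
  (forall (f : 'rV[R]_dx * 'rV[R]_dy -> R) (Cf kappa : R),
     0 <= kappa ->
     lipschitz_const (@eucl_dist_prod R dx dy) Cf f ->
     ph_lipschitz kappa (argmin g) ->
     lipschitz_const (@eucl_dist R dx) ((kappa + 1) * Cf) (opt_value f g)) /\
  (* (f) *)
  (forall Cf Cphi : R,
     0 < Cf ->
     (forall f : 'rV[R]_dx * 'rV[R]_dy -> R,
        lipschitz_const (@eucl_dist_prod R dx dy) Cf f ->
        lipschitz_const (@eucl_dist R dx) Cphi (opt_value f g)) ->
     ph_lipschitz (Cphi / Cf) (argmin g)).
Proof.
split; first by move=> f; exact: opt_value_continuous.
split; first exact: argmin_continuous.
split; first by move=> f; exact: opt_value_locally_lipschitz.
split; first exact: argmin_locally_lipschitz.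
split; first by move=> f Cf kappa; exact: opt_value_lipschitz.
by move=> Cf Cphi; exact: argmin_lipschitz.
Qed.
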